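(* Let $n\geq 5$. If an integral binary $n$-ic form $f(x,y)=a_0x^n+\cdots+a_ny^n$ (with $a_i\in\mathbb Z$) is irreducible over $\mathbb Q$ with Galois group $S_n$, then $f$ has no nontrivial projective linear automorphisms over $\bar{\mathbb Q}$; that is, there is no element of ${\rm SL}_2(\bar{\mathbb Q})$ that stabilizes $f$ and induces a nontrivial permutation of the roots of $f$ in $\mathbb P^1(\bar{\mathbb Q})$.
   Context: ${\rm SL}_2(\bar{\mathbb Q})$ acts on binary forms by $(\gamma\cdot f)(x,y)=f((x,y)\cdot\gamma)$, and correspondingly by Möbius transformations on $\mathbb P^1(\bar{\mathbb Q})$, permuting the roots of any form it stabilizes. The Galois group of $f$ is the Galois group over $\mathbb Q$ of the splitting field of $f(x,1)$, viewed as a permutation group on the roots. *)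

(* Defs.v *)
From HB Require Import structures.
From mathcomp Require Import all_boot all_order all_algebra all_fingroup all_field.
From mathcomp Require Import mpoly.

Set Implicit Arguments.
Unset Strict Implicit.
Unset Printing Implicit Defensive.

Import GRing.Theory.
Local Open Scope ring_scope.

Definition binary_form (R : comNzRingType) (n : nat) (a : 'I_n.+1 -> R) :
    {mpoly R[2]} :=
  \sum_(i < n.+1) a i *: ('X_ord0 ^+ (n - i) * 'X_ord_max ^+ i).

(* [irreducible_poly] only covers univariate polynomials. *)
Definition irreducible_elt (R : idomainType) (p : R) : Prop :=
  [/\ p != 0, p \isn't a GRing.unit
    & forall q r : R, p = q * r ->
        (q \is a GRing.unit) || (r \is a GRing.unit)].

(* f(x, 1) *)
Definition dehomog (R : comNzRingType) (f : {mpoly R[2]}) : {poly R} :=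
  mmap (@polyC R) (tnth [tuple 'X; 1]) f.

(* The group Gal(L / Q) seen as a set of permutations of the indices of an
   enumeration [rs] of the roots. *)
Definition galois_perms (L : splittingFieldType rat) (n : nat)
    (rs : n.-tuple L) : {set 'S_n} :=
  [set s : 'S_n |
    [exists g in 'Gal({:L} / 1)%g,
      [forall i, g (tnth rs i) == tnth rs (s i)]]].

(* Splitting fields are unique up to isomorphism, so the existential over [L]
   (and over the enumeration [rs] of its roots) involves no choice. *)
Definition galois_group_is_Sym (n : nat) (p : {poly rat}) : Prop :=
  exists L : splittingFieldType rat,
    let pL := map_poly (in_alg L) p in
    splittingFieldFor 1%VS pL {:L}%VS /\
    exists rs : n.-tuple L,
      [/\ uniq rs, forall x : L, (x \in rs) = root pL x
        & galois_perms rs = [set: 'S_n]].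

Section ProjectiveLine.
Variable F : fieldType.

Definition SL2 := {g : 'M[F]_2 | \det g == 1}.

(* (g . f)(x, y) = f((x, y) * g) *)
Definition SL2_act (g : SL2) (f : {mpoly F[2]}) : {mpoly F[2]} :=
  f \mPo [tuple \sum_(i < 2) val g i j *: 'X_i | j < 2].

Definition stabilizes (g : SL2) (f : {mpoly F[2]}) : Prop := SL2_act g f = f.

Definition P1 := {V : {vspace 'rV[F]_2} | \dim V == 1%N}.

Lemma moebius_subproof (g : SL2) (P : P1) :
  \dim (linfun (mulmxr (val g)) @: val P)%VS == 1%N.
Proof.
case: g P => g /= /eqP dg [V /= /eqP dV].
have ug : g \in unitmx by rewrite unitmxE dg unitr1.
rewrite limg_dim_eq ?dV //.
apply/eqP; rewrite -subv0; apply/subvP => v.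
rewrite memv_cap memv_ker lfunE /= memv0 => /andP[_ /eqP vg0].
by rewrite -(mulmxK ug v) vg0 mul0mx.
Qed.

(* [x : y] |-> [(x, y) * g]. This is the inverse of the transformation that
   makes SL2 act on the left; the fixed points are the same. *)
Definition moebius (g : SL2) (P : P1) : P1 :=
  exist (fun V : {vspace 'rV[F]_2} => \dim V == 1%N) _ (moebius_subproof g P).

Definition proj_root (f : {mpoly F[2]}) (P : P1) : Prop :=
  forall v : 'rV[F]_2, v \in val P -> f.@[v 0] = 0.

Lemma stabilizes_proj_root (g : SL2) (f : {mpoly F[2]}) (P : P1) :
  stabilizes g f -> proj_root f P -> proj_root f (moebius g P).
Proof.
move=> gf rP v /memv_imgP[u uP ->]; rewrite lfunE /=.
rewrite -(rP u uP) -[in RHS]gf /SL2_act comp_mpoly_meval.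
apply: meval_eq => j; rewrite tnth_map tnth_ord_tuple mxE raddf_sum /=.
by apply: eq_bigr => i _; rewrite mevalZ mevalXU mulrC.
Qed.

Definition permutes_roots_nontrivially (g : SL2) (f : {mpoly F[2]}) : Prop :=
  exists P : P1, proj_root f P /\ moebius g P != P.

End ProjectiveLine.

(* Main.v *)
Require Import Defs.
From HB Require Import structures.
From mathcomp Require Import all_boot all_order all_algebra all_fingroup all_solvable all_field.
From mathcomp Require Import mpoly ring.

(* The permutations of the roots that preserve all cross-ratios form a subgroup
   of S_n.  Galois automorphisms commute with cross-ratios, so when the Galois
   group is S_n this subgroup is normal; if it is nontrivial, it contains A_n by
   simplicity of A_n for n >= 5.  It then contains (a b)(c d) and (a c)(b d),
   both fixing a fifth root e.  Moving e to infinity, these are the affine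
   involutions u |-> a + b - u and u |-> a + c - u with a + b = c + d and
   a + c = b + d, whence 2b = 2c, a contradiction.  A projective automorphism
   of f permutes the roots (all finite, as f has n distinct affine roots)
   preserving cross-ratios over the algebraic numbers; an embedding of the
   splitting field transfers this to the splitting field, so the permutation is
   trivial. *)

Set Implicit Arguments.
Unset Strict Implicit.
Unset Printing Implicit Defensive.

Import GRing.Theory Num.Theory.
Local Open Scope ring_scope.

(** * Embedding number fields in the algebraic numbers *)

Lemma pchar_ratExt (L : fieldExtType rat) : [pchar L] =i pred0.
Proof. by move=> p; rewrite (pchar_lalg L) pchar_num. Qed.

(** By the primitive element theorem each element of [L] is q(z) with q rational; send it to q(w),
    where [w] is an algebraic number with the same minimal polynomial as [z]. *)
Lemma number_field_embedding (L : fieldExtType rat) :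
  inhabited {rmorphism L -> algC}.
Proof.
pose z := separable_generator 1%AS {:L}%AS.
have full_z : fullv = <<1; z>>%VS :> {vspace L}.
  apply: (eq_adjoin_separable_generator (E := {:L}%AS) (K := 1%AS)).
    by apply/separableP => x _; apply: pcharf0_separable; apply: pchar_ratExt.
  exact: subvf.
have /polyOver1P[p Dp] := minPolyOver 1%AS z.
have [w pw] : exists w : algC, root (map_poly ratr p) w.
  apply/closed_rootP; rewrite size_map_poly.
  by rewrite -(size_map_poly (in_alg L)) -Dp size_minPoly.
pose ev (q : {poly rat}) := (map_poly ratr q).[w].
(* The value at [w] does not depend on the polynomial chosen: the minimal polynomial of [z] divides
   q - r and vanishes at [w]. *)
have ev_inj q r : (map_poly (in_alg L) q).[z] = (map_poly (in_alg L) r).[z] ->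
    ev q = ev r.
  move=> qr; apply/eqP; rewrite -subr_eq0 /ev -hornerN -hornerD -rmorphB /=.
  have : p %| q - r.
    rewrite -(dvdp_map (in_alg L)) -Dp minPoly_dvdp //.
      by apply/polyOver1P; exists (q - r).
    by rewrite rootE rmorphB hornerD hornerN qr subrr.
  by case/dvdpP => t ->; rewrite rmorphM hornerM (rootP pw) mulr0.
have rep x : {q : {poly rat} | (map_poly (in_alg L) q).[z] == x}.
  apply: sigW.
  have /Fadjoin_polyP[q /polyOver1P[r ->] ->] : x \in <<1; z>>%VS.
    by rewrite -full_z memvf.
  by exists r.
pose iota x := ev (sval (rep x)).
have iotaE q x : (map_poly (in_alg L) q).[z] = x -> iota x = ev q.
  by move=> qx; apply: ev_inj; rewrite qx; apply/eqP/(svalP (rep x)).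
have repE x : (map_poly (in_alg L) (sval (rep x))).[z] = x.
  exact/eqP/(svalP (rep x)).
have iotaB : {morph iota : x y / x - y}.
  move=> x y; rewrite (iotaE (sval (rep x) - sval (rep y))).
    by rewrite /ev rmorphB hornerD hornerN.
  by rewrite rmorphB hornerD hornerN !repE.
have iotaM : monoid_morphism iota.
  split=> [|x y].
    by rewrite (iotaE 1) /ev rmorph1 hornerC.
  rewrite (iotaE (sval (rep x) * sval (rep y))) ?/ev ?rmorphM ?hornerM //.
  by rewrite !repE.
pose aM := GRing.isZmodMorphism.Build L algC iota iotaB.
pose mM := GRing.isMonoidMorphism.Build L algC iota iotaM.
pose f : {rmorphism L -> algC} := HB.pack iota aM mM.
exact: (inhabits f).
Qed.

(** * Normal subgroups of the symmetric group *)

Lemma exists_notin (T : finType) (s : seq T) :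
  (size s < #|T|)%N -> exists x, x \notin s.
Proof.
move=> sT; apply/existsP; apply: contraLR sT.
rewrite negb_exists -leqNgt => /forallP sub.
apply: leq_trans (card_size s); apply/subset_leq_card/subsetP => x _.
by rewrite -[_ \in _]negbK.
Qed.

Lemma perm_neq1 (T : finType) (s : {perm T}) :
  s != 1%g -> exists x, s x != x.
Proof.
move=> s1; apply/existsP; apply: contraR s1.
rewrite negb_exists => /forallP fix_s; apply/eqP/permP => x.
by rewrite perm1; apply/eqP; rewrite -[_ == _]negbK.
Qed.

Section NormalSubgroups.
Variable T : finType.
Hypothesis T5 : (5 <= #|T|)%N.
Local Open Scope group_scope.

(** By simplicity [G] meets the alternating group trivially or contains it. In the first case the
    commutator of a transposition with [s] in [G], being even and in [G], is trivial; a
    transposition moved by [s] refutes this. *)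
Lemma Alt_sub_normal_Sym (G : {group {perm T}}) :
  G <| 'Sym_T -> G :!=: 1 -> 'Alt_T \subset G.
Proof.
case/andP=> sGS nGS ntG.
have [_ simA] := simpleP _ (simple_Alt5 T5).
have nAG : ('Alt_T :&: G)%G <| 'Alt_T.
  rewrite /normal subsetIl normsI ?normG //.
  exact: subset_trans (Alt_subset T) nGS.
case: (simA _ nAG) => AG.
  have [s Gs /perm_neq1[a sa]] := trivgPn _ ntG.
  have [c] : exists c, c \notin [:: a; s a].
    by apply: exists_notin; apply: leq_trans T5.
  rewrite !inE negb_or => /andP[ca csa].
  pose t := tperm a c.
  have : [~ t, s] \in 'Alt_T :&: G.
    rewrite inE Alt_even commgEr odd_permM odd_permJ odd_permV addbb.
    by rewrite groupM ?memJ_norm ?groupV ?(subsetP nGS) ?inE.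
  (* A trivial commutator means that (s a, s c) and (a, c) are the same transposition; the second
     fixes [s a], so s c = s a. *)
  rewrite [_ :&: _]AG => /set1gP/eqP/conjg_fixP; rewrite tpermJ => /permP/(_ (s a)).
  rewrite tpermL (tpermD _ csa) 1?eq_sym // => /perm_inj ac.
  by rewrite ac eqxx in ca.
by have := subsetIr 'Alt_T G; rewrite [_ :&: _]AG.
Qed.

End NormalSubgroups.

(** * Cross-ratios and the permutations preserving them *)

Section CrossRatio.
Variables (F : fieldType) (T : finType) (x : T -> F).

(* With [y / 0 = 0] this is a total function, equal to [0] as soon as
   [i = l] or [j = k]. *)
Definition cross_ratio (i j k l : T) : F :=
  ((x i - x k) * (x j - x l)) / ((x i - x l) * (x j - x k)).

Definition cross_ratio_stab : {set {perm T}} :=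
  [set s : {perm T} | [forall i, forall j, forall k, forall l,
    cross_ratio (s i) (s j) (s k) (s l) == cross_ratio i j k l]].

Lemma cross_ratio_stabP (s : {perm T}) :
  reflect (forall i j k l,
             cross_ratio (s i) (s j) (s k) (s l) = cross_ratio i j k l)
          (s \in cross_ratio_stab).
Proof.
rewrite inE; apply: (iffP idP) => [/forallP h i j k l|h].
  by have /forallP/(_ j)/forallP/(_ k)/forallP/(_ l)/eqP := h i.
by do 4![apply/forallP => ?]; rewrite h.
Qed.

Lemma cross_ratio_stab_group_set : group_set cross_ratio_stab.
Proof.
apply/group_setP; split=> [|s t /cross_ratio_stabP hs /cross_ratio_stabP ht].
  by apply/cross_ratio_stabP => i j k l; rewrite !perm1.
by apply/cross_ratio_stabP => i j k l; rewrite !permM ht hs.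
Qed.

Canonical cross_ratio_stab_group := Group cross_ratio_stab_group_set.

(** The field automorphism inducing [t] carries each cross-ratio to that of the [t]-images, so it
    turns invariance under [s] into invariance under the conjugate of [s] by [t]. *)
Lemma cross_ratio_stab_normal :
  (forall s : {perm T}, exists h : {rmorphism F -> F},
     forall i, h (x i) = x (s i)) ->
  (cross_ratio_stab <| 'Sym_T)%g.
Proof.
move=> gal; apply/andP; split; first exact/subsetP.
apply/subsetP => t _; rewrite inE; apply/subsetP => _ /imsetP[s /cross_ratio_stabP hs ->].
have [h hx] := gal t.
have hcr i j k l : h (cross_ratio i j k l) = cross_ratio (t i) (t j) (t k) (t l).
  by rewrite /cross_ratio fmorph_div !rmorphM !rmorphB !hx.
apply/cross_ratio_stabP => i j k l.
rewrite -[i](permKV t) -[j](permKV t) -[k](permKV t) -[l](permKV t) !permJ.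
by rewrite -!hcr hs.
Qed.

(** A Möbius map multiplies the difference of two points by the determinant over the product of
    their denominators. *)
Lemma moebius_cross_ratio_stab (s : {perm T}) (p q r t : F) :
  p * t - q * r != 0 -> (forall i, q * x i + t != 0) ->
  (forall i, x (s i) = (p * x i + r) / (q * x i + t)) ->
  s \in cross_ratio_stab.
Proof.
move=> det0 den0 xs; apply/cross_ratio_stabP => i j k l.
have xsB i1 i2 : x (s i1) - x (s i2) =
    (x i1 - x i2) * ((p * t - q * r) / ((q * x i1 + t) * (q * x i2 + t))).
  by rewrite !xs; field; rewrite !den0.
(* Each of the four points occurs once above and once below in a cross-ratio, so both products
   acquire the same factor [K]. Cancelling it is valid even when the lower product is 0. *)
pose K := (p * t - q * r) ^+ 2 /
  ((q * x i + t) * (q * x j + t) * (q * x k + t) * (q * x l + t)).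
have K0 : K != 0 by rewrite !mulf_neq0 ?invr_eq0 ?mulf_neq0.
rewrite /cross_ratio -[RHS]mul1r -(divff K0) mulf_div !xsB.
by congr (_ / _); rewrite /K; field; rewrite !den0.
Qed.

Hypothesis x_inj : injective x.

(* Moving [x e] to infinity by [u = 1 / (x - x e)], the transformation is an
   affine involution of the [u]-line, that is [u |-> s - u]. *)
Lemma double_tperm_stab_sum a b c d e : uniq [:: a; b; c; d; e] ->
  (tperm a b * tperm c d)%g \in cross_ratio_stab ->
  (x a - x e)^-1 + (x b - x e)^-1 = (x c - x e)^-1 + (x d - x e)^-1.
Proof.
move=> uniq5 stab_s; move: uniq5; rewrite /= !inE !negb_or.
move=> /and5P[/and4P[ab ac ad ae] /and3P[bc bd be] /andP[cd ce] de _].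
have nz i j : i != j -> x i - x j != 0 by rewrite subr_eq0 (inj_eq x_inj).
have /cross_ratio_stabP/(_ a b c e) := stab_s.
have -> : (tperm a b * tperm c d)%g a = b by rewrite permM tpermL tpermD // eq_sym.
have -> : (tperm a b * tperm c d)%g b = a by rewrite permM tpermR tpermD // eq_sym.
have -> : (tperm a b * tperm c d)%g c = d by rewrite permM (tpermD ac bc) tpermL.
have -> : (tperm a b * tperm c d)%g e = e by rewrite permM (tpermD ae be) tpermD.
rewrite /cross_ratio => /eqP.
rewrite eqr_div ?mulf_neq0 ?nz // => /eqP E.
set A := x a - x e in E *; set B := x b - x e in E *.
set C := x c - x e; set D := x d - x e.
(* With [x e] as origin, [E] reads A^2 (B - C)(B - D) = B^2 (A - C)(A - D); the difference of its
   sides is divisible by A - B. *)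
have : (x a - x b) * ((A + B) * (C * D) - (C + D) * (A * B)) = 0.
  move/eqP: E; rewrite -subr_eq0 => /eqP <-; rewrite /A /B /C /D; ring.
move/eqP; rewrite mulf_eq0 (negPf (nz _ _ ab)) /= => /eqP K.
have [nA nB nC nD] : [/\ A != 0, B != 0, C != 0 & D != 0] by split; apply: nz.
apply/eqP; rewrite -subr_eq0; apply/eqP.
have -> : A^-1 + B^-1 - (C^-1 + D^-1) =
    ((A + B) * (C * D) - (C + D) * (A * B)) / (A * B * C * D).
  by field; rewrite nA nB nC nD.
by rewrite K mul0r.
Qed.

Lemma Alt_not_sub_cross_ratio_stab : (5 <= #|T|)%N -> 2%:R != 0 :> F ->
  ~~ ('Alt_T \subset cross_ratio_stab)%g.
Proof.
move=> T5 F2; apply/negP => /subsetP sA.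
have Alt2 a b c d : a != b -> c != d ->
    (tperm a b * tperm c d)%g \in cross_ratio_stab.
  by move=> ab cd; apply: sA; rewrite Alt_even odd_permM !odd_tperm ab cd.
have [s us] : exists s : 5.-tuple T, uniq s.
  pose en := enum T.
  have sz : size (take 5 en) == 5%N by rewrite size_takel // /en -cardT.
  by exists (Tuple sz); rewrite /= take_uniq // enum_uniq.
have [a [b [c [d [e u]]]]] : exists a b c d e : T, uniq [:: a; b; c; d; e].
  case: s us => [[|a [|b [|c [|d [|e []]]]]]] //= _ us.
  by exists a, b, c, d, e.
have u' : uniq [:: a; c; b; d; e].
  rewrite -(perm_uniq (s1 := [:: a; b; c; d; e])) // perm_cons.
  by rewrite (perm_catCA [:: b] [:: c] [:: d; e]).
move: (u) (u'); rewrite /= !inE !negb_or.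
move=> /and5P[/and4P[ab ac ad ae] /and3P[bc bd be] /andP[cd ce] de _] _.
have := double_tperm_stab_sum u (Alt2 _ _ _ _ ab cd).
have := double_tperm_stab_sum u' (Alt2 _ _ _ _ ac bd).
set A := (_ - _)^-1; set C := (_ - _)^-1; set B := (_ - _)^-1; set D := (_ - _)^-1.
move=> ACBD ABCD.
have : 2%:R * (B - C) = 0.
  (* Subtracting the two relations cancels [A] and [D]. *)
  have -> : 2%:R * (B - C) = (A + B - (C + D)) - (A + C - (B + D)) by ring.
  by rewrite ACBD ABCD !subrr.
move/eqP; rewrite mulf_eq0 (negPf F2) /= subr_eq0 => /eqP/invr_inj/addIr/x_inj bc'.
by rewrite bc' eqxx in bc.
Qed.

Lemma cross_ratio_stab_trivial : (5 <= #|T|)%N -> 2%:R != 0 :> F ->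
  (forall s : {perm T}, exists h : {rmorphism F -> F},
     forall i, h (x i) = x (s i)) ->
  cross_ratio_stab = 1%g.
Proof.
move=> T5 F2 gal; apply/eqP; apply: contraR (Alt_not_sub_cross_ratio_stab T5 F2).
exact: (Alt_sub_normal_Sym T5 (G := cross_ratio_stab_group))
  (cross_ratio_stab_normal gal).
Qed.

End CrossRatio.

(** * Coefficients and values of binary forms *)

Section FormMaps.
Variables (R S : comNzRingType) (n : nat).

Lemma eq_binary_form (a b : 'I_n.+1 -> R) :
  a =1 b -> binary_form a = binary_form b.
Proof. by move=> ab; apply: eq_bigr => i _; rewrite ab. Qed.

Lemma map_binary_form (h : {rmorphism R -> S}) (a : 'I_n.+1 -> R) :
  map_mpoly h (binary_form a) = binary_form (h \o a).
Proof.
rewrite raddf_sum; apply: eq_bigr => i _ /=.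
by rewrite map_mpolyZ rmorphM !rmorphXn /= !map_mpolyX.
Qed.

Lemma meval_binary_form (a : 'I_n.+1 -> R) (v : 'I_2 -> R) :
  (binary_form a).@[v] =
    \sum_(i < n.+1) a i * (v ord0 ^+ (n - i) * v ord_max ^+ i).
Proof.
rewrite raddf_sum; apply: eq_bigr => i _ /=.
by rewrite mevalZ mevalM !rmorphXn /= !mevalXU.
Qed.

Lemma dehomogE (a : 'I_n.+1 -> R) :
  dehomog (binary_form a) = \sum_(i < n.+1) a i *: 'X^(n - i).
Proof.
rewrite /dehomog raddf_sum; apply: eq_bigr => i _ /=.
rewrite mmapZ rmorphM !rmorphXn /= !mmapX !mmap1U.
by rewrite expr1n mulr1 mul_polyC.
Qed.

(** The exponents [n - i] are pairwise distinct, so setting y = 1 merges no coefficients. *)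
Lemma coef_dehomog (a : 'I_n.+1 -> R) (i : 'I_n.+1) :
  (dehomog (binary_form a))`_(n - i) = a i.
Proof.
rewrite dehomogE coef_sum (bigD1 i) //= coefZ coefXn eqxx mulr1.
rewrite big1 ?addr0 // => j ji; rewrite coefZ coefXn.
case: eqP => [E|]; last by rewrite mulr0.
by case/eqP: ji; apply/val_inj; rewrite /= -(subKn (leq_ord j)) -E subKn ?leq_ord.
Qed.

Lemma size_dehomog (a : 'I_n.+1 -> R) :
  (size (dehomog (binary_form a)) <= n.+1)%N.
Proof.
rewrite dehomogE; apply: (leq_trans (size_sum _ _ _)); apply/bigmax_leqP => i _.
by rewrite (leq_trans (size_scale_leq _ _)) // size_polyXn ltnS leq_subr.
Qed.

Lemma dehomog_eq0 (a : 'I_n.+1 -> R) :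
  dehomog (binary_form a) = 0 -> binary_form a = 0.
Proof.
move=> p0; rewrite /binary_form big1 // => i _.
by rewrite -(coef_dehomog a i) p0 coef0 scale0r.
Qed.

End FormMaps.

Lemma map_dehomog (R S : comNzRingType) (n : nat) (h : {rmorphism R -> S})
    (a : 'I_n.+1 -> R) :
  map_poly h (dehomog (binary_form a)) = dehomog (binary_form (h \o a)).
Proof.
rewrite !dehomogE raddf_sum; apply: eq_bigr => i _ /=.
by rewrite map_polyZ map_polyXn.
Qed.

(** * Roots of a form and the matrices stabilizing it *)

Section FormRoots.
Variables (F : fieldType) (n : nat) (a : 'I_n.+1 -> F) (x : 'I_n -> F).
Local Notation f := (binary_form a).
Hypotheses (x_inj : injective x) (f_root : forall i, root (dehomog f) (x i)).
Hypothesis f_neq0 : dehomog f != 0.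

Let xs := [seq x i | i : 'I_n].

Let xs_uniq : uniq xs. Proof. by rewrite map_inj_uniq ?enum_uniq. Qed.

Let xs_roots : all (root (dehomog f)) xs.
Proof. by apply/allP => _ /mapP[i _ ->]. Qed.

(** A further root would give n + 1 distinct roots in degree at most n. *)
Lemma root_dehomogP t : root (dehomog f) t -> exists i, t = x i.
Proof.
move=> rt; case t_xs: (t \in xs); first by case/mapP: t_xs => i; exists i.
have := max_poly_roots (rs := t :: xs) f_neq0.
rewrite /= rt t_xs xs_roots xs_uniq size_map size_enum_ord => /(_ isT isT).
by rewrite ltnNge size_dehomog.
Qed.

(** The [n] distinct roots force the degree to be exactly [n]. Hence the point at infinity is not a
    zero of the form. *)
Lemma lead_coef_form_neq0 : a ord0 != 0.
Proof.
have := max_poly_roots f_neq0 xs_roots xs_uniq.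
rewrite size_map size_enum_ord => sz.
have size_f : size (dehomog f) = n.+1 by apply/eqP; rewrite eqn_leq size_dehomog.
have := lead_coef_eq0 (dehomog f); rewrite (negPf f_neq0) lead_coefE size_f /=.
by rewrite -[n in _`_n]subn0 (coef_dehomog a ord0) => ->.
Qed.

Definition affine_pt (t : F) : 'rV[F]_2 := \row_j (if j == ord0 then t else 1).

Lemma affine_pt0 t : affine_pt t 0 ord0 = t. Proof. by rewrite mxE. Qed.
Lemma affine_pt1 t : affine_pt t 0 ord_max = 1. Proof. by rewrite mxE. Qed.

Lemma affine_ptZ0 c t : (c *: affine_pt t) 0 ord0 = c * t.
Proof. by rewrite mxE affine_pt0. Qed.

Lemma affine_ptZ1 c t : (c *: affine_pt t) 0 ord_max = c.
Proof. by rewrite mxE affine_pt1 mulr1. Qed.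

Lemma rV2_eq (u v : 'rV[F]_2) :
  u 0 ord0 = v 0 ord0 -> u 0 ord_max = v 0 ord_max -> u = v.
Proof.
move=> e0 e1; apply/rowP => j.
by case/orP: (orbN (j == ord0)) => [/eqP->|jn0] //; have -> : j = ord_max
  by apply/val_inj; case: j jn0 => [[|[|]]].
Qed.

Lemma meval_dehomog (v : 'rV[F]_2) : v 0 ord_max != 0 ->
  f.@[v 0] = v 0 ord_max ^+ n * (dehomog f).[v 0 ord0 / v 0 ord_max].
Proof.
move=> v1; rewrite meval_binary_form dehomogE horner_sum mulr_sumr.
apply: eq_bigr => i _; rewrite hornerZ hornerXn [RHS]mulrCA expr_div_n; congr (_ * _).
have -> : v 0 ord_max ^+ n = v 0 ord_max ^+ i * v 0 ord_max ^+ (n - i).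
  by rewrite -exprD subnKC ?leq_ord.
by rewrite -mulrA [X in _ = _ * X]mulrC divfK ?expf_neq0 // mulrC.
Qed.

Lemma form_zero_affine (v : 'rV[F]_2) : v != 0 -> f.@[v 0] = 0 ->
  v 0 ord_max != 0 /\ exists i, v = v 0 ord_max *: affine_pt (x i).
Proof.
move=> v0 fv0.
have v1 : v 0 ord_max != 0.
  apply: contraNneq v0 => v1; apply/eqP/rV2_eq; rewrite mxE //.
  move: fv0; rewrite meval_binary_form (bigD1 ord0) //= big1 => [|i i0].
    move/eqP; rewrite addr0 mulr1 subn0 mulf_eq0 (negPf lead_coef_form_neq0) /=.
    by rewrite expf_eq0 => /andP[_ /eqP].
  rewrite v1 expr0n; have -> : (i == 0 :> nat) = false by apply: negPf.
  by rewrite !mulr0.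
split=> //.
move/eqP: fv0; rewrite meval_dehomog // mulf_eq0 expf_eq0 (negPf v1) andbF /=.
case/root_dehomogP => i xi; exists i.
by apply: rV2_eq; rewrite ?affine_ptZ0 ?affine_ptZ1 // -xi mulrC divfK.
Qed.

Variable g : SL2 F.
Hypothesis g_f : stabilizes g f.

Lemma stab_meval (v : 'rV[F]_2) : f.@[(v *m val g) 0] = f.@[v 0].
Proof.
rewrite -[in RHS]g_f /SL2_act comp_mpoly_meval.
apply: meval_eq => j; rewrite tnth_map tnth_ord_tuple mxE raddf_sum /=.
by apply: eq_bigr => i _; rewrite mevalZ mevalXU mulrC.
Qed.

Let g_unit : val g \in unitmx.
Proof. by rewrite unitmxE (eqP (valP g)) unitr1. Qed.

(** The matrix preserves values of the form, hence its zeros, and all nonzero zeros are multiples of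
    the root points. The scalar [d] is the denominator of the Möbius map at [x i]. *)
Lemma stab_perm_roots : exists s : {perm 'I_n}, forall i,
  let d := (affine_pt (x i) *m val g) 0 ord_max in
  d != 0 /\ affine_pt (x i) *m val g = d *: affine_pt (x (s i)).
Proof.
have pt_neq0 t : affine_pt t != 0.
  apply/eqP => /rowP/(_ ord_max); rewrite affine_pt1 mxE => /eqP.
  by rewrite oner_eq0.
have img i : exists j, let d := (affine_pt (x i) *m val g) 0 ord_max in
  d != 0 /\ affine_pt (x i) *m val g = d *: affine_pt (x j).
  have [||d0 [j E]] := form_zero_affine (v := affine_pt (x i) *m val g).
  - apply: contraNneq (pt_neq0 (x i)) => E.
    by rewrite -(mulmxK g_unit (affine_pt (x i))) E mul0mx.
  - rewrite stab_meval meval_dehomog affine_pt1 ?oner_eq0 // affine_pt0 divr1.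
    by rewrite (rootP (f_root i)) mulr0.
  by exists j.
have [h hP] := fin_all_exists img.
have h_inj : injective h.
  move=> i j hij; have [/= di Ei] := hP i; have [/= dj Ej] := hP j.
  rewrite hij in Ei; move: Ei Ej di dj; set c := (_ *m _) _ _; set d := (_ *m _) _ _.
  move=> Ei Ej c0 d0.
  have : affine_pt (x i) = (c / d) *: affine_pt (x j).
    apply: (can_inj (mulmxK g_unit)).
    by rewrite -scalemxAl Ei Ej scalerA divfK.
  (* Both points have last coordinate 1, so the factor is 1. *)
  move=> E; have := congr1 (fun v : 'rV_2 => v 0 ord_max) E.
  rewrite affine_ptZ1 affine_pt1 => cd.
  have := congr1 (fun v : 'rV_2 => v 0 ord0) E.
  by rewrite affine_ptZ0 affine_pt0 -cd mul1r => /x_inj.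
by exists (perm h_inj) => i; rewrite permE.
Qed.

(** Since row vectors are multiplied on the right, the numerator of the Möbius map comes from the
    first column of [g] and the denominator from the second. *)
Lemma stab_cross_ratio (s : {perm 'I_n}) :
  (forall i, let d := (affine_pt (x i) *m val g) 0 ord_max in
    d != 0 /\ affine_pt (x i) *m val g = d *: affine_pt (x (s i))) ->
  s \in cross_ratio_stab x.
Proof.
move=> sP.
have ptM t j : (affine_pt t *m val g) 0 j = val g ord0 j * t + val g ord_max j.
  rewrite mxE !big_ord_recl big_ord0 addr0; have -> : lift ord0 ord0 = ord_max :> 'I_2.
    exact: val_inj.
  by rewrite affine_pt0 affine_pt1 mul1r mulrC.
have det_g : val g ord0 ord0 * val g ord_max ord_max -
    val g ord0 ord_max * val g ord_max ord0 = 1.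
  apply: etrans (eqP (valP g)).
  rewrite (expand_det_row _ ord0) !big_ord_recl big_ord0 addr0.
  rewrite /cofactor !det_mx11 !mxE /= !addn0 expr0 mul1r expr1 mulN1r mulrN.
  by congr (_ * _ - _ * _); congr (val g _ _); apply/val_inj.
apply: (@moebius_cross_ratio_stab _ _ _ _ (val g ord0 ord0) (val g ord0 ord_max)
  (val g ord_max ord0) (val g ord_max ord_max)) => [|i|i].
- by rewrite det_g oner_eq0.
- by rewrite -ptM; case: (sP i).
have [/= d0 /(congr1 (fun v : 'rV_2 => v 0 ord0))] := sP i.
rewrite affine_ptZ0 !ptM => E; rewrite ptM in d0.
by rewrite E mulrAC divff ?mul1r.
Qed.

(** Every zero of the form in the projective line is spanned by a root point, here an eigenvector;
    its line is mapped into itself, and equal dimensions give equality. *)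
Lemma stab_trivial_perm :
  (forall i, exists d, affine_pt (x i) *m val g = d *: affine_pt (x i)) ->
  ~ permutes_roots_nontrivially g f.
Proof.
move=> fix_g [P [fP /eqP]]; apply; apply/val_inj => /=.
apply/eqP; rewrite eqEdim (eqP (moebius_subproof g P)) (eqP (valP P)) leqnn andbT.
apply/subvP => w /memv_imgP[u uP ->]; rewrite lfunE /=.
have [->|u0] := eqVneq u 0; first by rewrite mul0mx mem0v.
have [_ [i uE]] := form_zero_affine u0 (fP u uP).
have [d dE] := fix_g i.
by rewrite uE -scalemxAl dE scalerA mulrC -scalerA -uE memvZ.
Qed.

End FormRoots.

Theorem theorem3 (n : nat) (hn : (5 <= n)%N) (a : 'I_n.+1 -> int)
    (f := binary_form a)
    (fQ := map_mpoly (intr : int -> rat) f)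
    (fC := map_mpoly (intr : int -> algC) f)
    (f_irr : irreducible_elt fQ)
    (f_gal : galois_group_is_Sym n (dehomog fQ)) :
  ~ exists g : SL2 algC, stabilizes g fC /\ permutes_roots_nontrivially g fC.
Proof.
case=> g [g_f g_perm].
have [L [_ [rs [rs_uniq rs_root rs_gal]]]] := f_gal.
have [iota] := number_field_embedding L.
(* Routing the coefficients through [L] makes the roots of [fC] the images of [rs] under [iota]. *)
pose aC i : algC := iota (in_alg L (a i)%:~R).
have fQE : fQ = binary_form (intr \o a) by exact: map_binary_form.
have fCE : fC = binary_form aC.
  rewrite /fC map_binary_form; apply: eq_binary_form => i.
  by rewrite /aC [LHS]/= !rmorph_int.
pose th i := tnth rs i.
have th_inj : injective th by move=> i j; apply/tuple_uniqP.
pose x i := iota (th i).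
have x_inj : injective x by move=> i j /fmorph_inj/th_inj.
have pC : dehomog fC = map_poly iota (map_poly (in_alg L) (dehomog fQ)).
  by rewrite fCE fQE !map_dehomog.
have fC_neq0 : dehomog fC != 0.
  rewrite pC !map_poly_eq0; case: f_irr => fQ0 _ _.
  by apply: contraNneq fQ0; rewrite fQE => /dehomog_eq0 ->.
have fC_root i : root (dehomog fC) (x i).
  by rewrite pC fmorph_root -rs_root mem_tnth.
rewrite fCE in g_f g_perm fC_neq0 fC_root.
have [s sP] := stab_perm_roots x_inj fC_root fC_neq0 g_f.
(* Cross-ratios commute with field morphisms, so the injective [iota] reflects their equalities back
   to [L], where the Galois group acts. *)
have : s \in cross_ratio_stab th.
  have /cross_ratio_stabP sx := stab_cross_ratio sP.
  apply/cross_ratio_stabP => i j k l; apply: (fmorph_inj iota).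
  by have := sx i j k l; rewrite /cross_ratio !fmorph_div !rmorphM !rmorphB.
rewrite cross_ratio_stab_trivial ?card_ord //.
- move/set1gP => s1; apply: (stab_trivial_perm x_inj fC_root fC_neq0 _ g_perm) => i.
  have [_ E] := sP i; rewrite s1 perm1 in E.
  by eexists; exact: E.
- by have /pcharf0P -> := pchar_ratExt L.
move=> t; have : t \in galois_perms rs by rewrite rs_gal inE.
rewrite inE => /existsP[h /andP[_ /forallP ht]].
by exists h => i; apply/eqP/ht.
Qed.
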